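(* Let $G$ be a connected graph with $n$ vertices and $m$ edges. Then $mx_k(G)=m-n+2$ for each integer $k$ with $3\leq k\leq n$.
   Context: All graphs are simple, finite and undirected. Colorings are arbitrary (not necessarily proper). A tree $T$ that is a subgraph of an edge-colored graph $H$ is a monochromatic tree if all edges of $T$ have the same color. For $S\subseteq V(H)$, a monochromatic $S$-tree is a monochromatic tree in $H$ whose vertex set contains $S$. For a connected graph $G$ and an integer $k$ with $2\leq k\leq |V(G)|$, an $MX_k$-coloring of $G$ is an edge-coloring of $G$ such that for every set $S$ of $k$ vertices of $G$ there exists a monochromatic $S$-tree. The $k$-monochromatic index $mx_k(G)$ is the maximum number of colors used in an $MX_k$-coloring of $G$. *)

(* Defs.v *)
From mathcomp Require Import all_boot.

Set Implicit Arguments.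
Unset Strict Implicit.
Unset Printing Implicit Defensive.

Record sgraph := SGraph {
  vertex :> finType;
  adj : rel vertex;
  adj_sym : symmetric adj;
  adj_irrefl : irreflexive adj
}.

Definition edges (G : sgraph) : {set {set G}} :=
  [set [set p.1; p.2] | p : G * G & adj p.1 p.2].

Definition connected_graph (G : sgraph) : Prop :=
  0 < #|G| /\ forall x y : G, connect (@adj G) x y.

(* A subgraph is given by its vertex set and its edge set, both explicit, so
   that it need not be induced and a single vertex is a (trivial) tree. *)
Record subgraph (G : sgraph) := Subgraph {
  sub_vertices : {set G};
  sub_edges : {set {set G}};
  sub_edgesP : sub_edges \subset edges G;
  sub_endpoints : forall e, e \in sub_edges -> e \subset sub_vertices
}.

Definition sub_adj (G : sgraph) (H : subgraph G) : rel G :=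
  fun x y => [set x; y] \in sub_edges H.

Definition connected_sub (G : sgraph) (H : subgraph G) : Prop :=
  sub_vertices H != set0 /\
  {in sub_vertices H &, forall x y, connect (sub_adj H) x y}.

(* The bound on the size excludes the closed walks x, y, x along one edge. *)
Definition acyclic (G : sgraph) (H : subgraph G) : Prop :=
  forall p : seq G, 2 < size p -> ~ ucycle (sub_adj H) p.

Definition is_tree (G : sgraph) (H : subgraph G) : Prop :=
  connected_sub H /\ acyclic H.

(* Only the values taken on [edges G] matter in an edge-coloring. *)
Definition coloring (G : sgraph) := {set G} -> nat.

Definition monochromatic (G : sgraph) (c : coloring G) (H : subgraph G) : Prop :=
  {in sub_edges H &, forall e f, c e = c f}.

Definition mono_Stree (G : sgraph) (c : coloring G) (S : {set G})
    (H : subgraph G) : Prop :=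
  [/\ is_tree H, monochromatic c H & S \subset sub_vertices H].

Definition MX_coloring (G : sgraph) (k : nat) (c : coloring G) : Prop :=
  forall S : {set G}, #|S| = k -> exists H : subgraph G, mono_Stree c S H.

Definition ncolors (G : sgraph) (c : coloring G) : nat :=
  size (undup [seq c e | e in edges G]).

(* [is_mx G k N] reads mx_k(G) = N: the maximum exists and equals N. *)
Definition is_mx (G : sgraph) (k N : nat) : Prop :=
  (exists2 c : coloring G, MX_coloring k c & ncolors c = N) /\
  (forall c : coloring G, MX_coloring k c -> ncolors c <= N).

(* Main.v *)
Require Import Defs.
From mathcomp Require Import all_boot.

Set Implicit Arguments.
Unset Strict Implicit.
Unset Printing Implicit Defensive.

(** Both inequalities come from breadth-first search trees. In the tree rooted
    at [v], each reachable vertex [x] other than [v] owns the edge joining it to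
    its parent; since parents are strictly closer to [v], distinct vertices own
    distinct edges.

    Lower bound: color a spanning tree, which has [n - 1] edges, with one color
    and give each of the [m - n + 1] other edges a color of its own. The
    spanning tree is a monochromatic [S]-tree for every [S]
    ([spanning_tree], [ncolors_collapse]).

    Upper bound ([ncolors_upper]): fix two distinct vertices [u] and [v]. As
    [3 <= k <= n], each triple [u, v, x] lies in a monochromatic tree, whose
    color is called [col x]. For [x] other than [u] and [v], let [g x] be the
    edge owned by [x] in the search tree rooted at [v] inside color [col x].
    The color of [g x] determines the search tree, so [g] is injective and hits
    [n - 2] edges. Every color still occurs after these edges are deleted: if
    the color is [col x] for some [x], then [u] is reachable from [v] in that
    color, and the edge owned by [u] there is not a value of [g]; otherwise none
    of its edges is a value of [g]. So there are at most [m - (n - 2)]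
    colors. *)

Lemma set2_eq (T : finType) (x y a b : T) :
  [set x; y] = [set a; b] -> x = a /\ y = b \/ x = b /\ y = a.
Proof.
move=> E.
have: x \in [set a; b] by rewrite -E set21.
have: y \in [set a; b] by rewrite -E set22.
have: a \in [set x; y] by rewrite E set21.
have: b \in [set x; y] by rewrite E set22.
rewrite !inE => /pred2P ? /pred2P ? /pred2P ? /pred2P ?.
by intuition congruence.
Qed.

Lemma exists_superset_card (T : finType) (A : {set T}) k :
  #|A| <= k <= #|T| -> exists2 S : {set T}, A \subset S & #|S| = k.
Proof.
elim: k => [|k IHk] /andP[].
  by rewrite leqn0 => /eqP A0 _; exists A.
rewrite leq_eqVlt => /orP[/eqP Ak _|Ak kT]; first by exists A.
case: IHk => [|S AS cS]; first by rewrite -ltnS Ak ltnW.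
have [x xS] : exists x, x \in ~: S.
  by apply/card_gt0P; rewrite -(ltn_add2l #|S|) cardsC addn0 cS.
exists (x |: S); first exact: subset_trans AS (subsetUr _ _).
by rewrite cardsU1 -in_setC xS cS.
Qed.

(** * Breadth-first search trees *)

Section SearchTree.

Variables (T : finType) (e : rel T) (v : T).

Definition walk (x : T) (n : nat) : bool :=
  [exists t : n.-tuple T, path e v t && (last v t == x)].

(** The search stops at [#|T|] because a simple path has fewer than [#|T|]
    edges; unreachable vertices get the junk value [#|T|]. *)
Definition dist (x : T) : nat := find (walk x) (iota 0 #|T|).

Lemma dist_le x n : walk x n -> dist x <= n.
Proof.
move=> w; rewrite leqNgt; apply/negP => lt_n.
have n_lt: n < #|T|.
  by apply: leq_trans lt_n _; rewrite -[leqRHS](size_iota 0) find_size.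
by have := before_find 0 lt_n; rewrite nth_iota // add0n w.
Qed.

(** Removing the loops of a path shows that [dist x] really is attained. *)
Lemma walk_dist x : connect e v x -> walk x (dist x).
Proof.
case/connectP=> p0 path0 ->; case/shortenP: path0 => p e_p uniq_p _.
have size_p : size p < #|T|.
  by rewrite -[_.+1]/(size (v :: p)) -(card_uniqP uniq_p) max_card.
have has_p : has (walk (last v p)) (iota 0 #|T|).
  apply/hasP; exists (size p); first by rewrite mem_iota.
  by apply/existsP; exists (in_tuple p); rewrite e_p eqxx.
have := nth_find 0 has_p; rewrite nth_iota ?add0n //.
by move: (has_p); rewrite has_find size_iota.
Qed.

(** Choosing the parent by a total function of the relation, rather than by an
    existential statement, makes the trees of infinitely many candidate colors
    available at once. *)
Definition parent (x : T) : T :=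
  odflt v [pick y | [&& e y x, connect e v y & dist y < dist x]].

(** The parent is found as the last vertex but one of a shortest path. *)
Lemma parentP x : connect e v x -> x != v ->
  [/\ e (parent x) x, connect e v (parent x) & dist (parent x) < dist x].
Proof.
move=> vx xv; rewrite /parent; case: pickP => [y /and3P[]//|none].
have /existsP[[p /= /eqP size_p] /andP[e_p last_p]] := walk_dist vx.
case/lastP: p => [|q z] in size_p e_p last_p.
  by rewrite -(eqP last_p) eqxx in xv.
move: e_p last_p; rewrite last_rcons rcons_path => /andP[e_q e_z] /eqP zx.
subst z.
have/negP[] := none (last v q); rewrite e_z /=; apply/andP; split.
  by apply/connectP; exists q.
rewrite -size_p size_rcons ltnS; apply: dist_le.
by apply/existsP; exists (in_tuple q); rewrite e_q eqxx.
Qed.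

Definition parent_edge (x : T) : {set T} := [set x; parent x].

(** If distinct [x] and [y] owned the same edge, each would be the parent of
    the other, hence strictly closer to the root than the other. *)
Lemma parent_edge_inj x y : connect e v x -> x != v ->
  connect e v y -> y != v -> parent_edge x = parent_edge y -> x = y.
Proof.
move=> vx xv vy yv /set2_eq [[-> _]//|[x_eq y_eq]].
have [[_ _ lt_x] [_ _ lt_y]] := (parentP vx xv, parentP vy yv).
by move: lt_x; rewrite y_eq ltnNge ltnW // {1}x_eq.
Qed.

End SearchTree.

(** In a cycle, a vertex maximizing [d] has two distinct neighbours on the
    cycle, and both would have to be its parent. *)
Lemma parent_cycle_free (T : finType) (d : T -> nat) (par : T -> T)
    (e : rel T) : symmetric e ->
  (forall x y, e x y -> d y <= d x -> y = par x) ->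
  forall p, 2 < size p -> ~ ucycle e p.
Proof.
move=> e_sym parE p size_p /andP[cyc_p uniq_p].
have [x0 x0p] : exists x, x \in p.
  by case: p size_p {cyc_p uniq_p} => // x p _; exists x; rewrite mem_head.
have [x xp x_max] := @arg_maxnP _ x0 [in p] d x0p.
(* The cycle is read starting from [x], so that [x] lies between [y] and [z]. *)
have [i q rot_p] := rot_to xp.
have q_le y : y \in q -> d y <= d x.
  by move=> yq; apply: x_max; rewrite /= -(mem_rot i) rot_p inE yq orbT.
move: size_p cyc_p uniq_p; rewrite -(size_rot i) -(rot_cycle i) -(rot_uniq i).
rewrite rot_p {rot_p}; case: q q_le => [//|y q].
case/lastP: q => [//|q z] q_le _ /=.
rewrite !rcons_path last_rcons => /and3P[xy _ zx] /and3P[_ + _].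
have -> : y = par x by apply: parE => //; apply: q_le; rewrite mem_head.
have -> : z = par x.
  apply: parE; first by rewrite e_sym.
  by apply: q_le; rewrite inE mem_rcons mem_head orbT.
by rewrite mem_rcons mem_head.
Qed.

(** * Colorings of a graph *)

Section Graph.

Variable G : sgraph.

Lemma mem_edges (x y : G) : ([set x; y] \in edges G) = adj x y.
Proof.
apply/imsetP/idP => [[[a b] ab]|xy]; last by exists (x, y); rewrite ?inE.
move: ab; rewrite inE /= => ab /set2_eq [[-> ->]|[-> ->]] //.
by rewrite adj_sym.
Qed.

Definition color_adj (c : coloring G) (i : nat) : rel G :=
  fun x y => adj x y && (c [set x; y] == i).

(** The color of a tree consisting of a single vertex is arbitrary. *)
Lemma mono_Stree_connect (c : coloring G) S H : mono_Stree c S H ->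
  exists i, {in S &, forall x y, connect (color_adj c i) x y}.
Proof.
case=> [[[_ conH] _] mono SH].
have [i Hi] : exists i, {in sub_edges H, forall f, c f = i}.
  have [->|[f fH]] := set_0Vmem (sub_edges H).
    by exists 0 => f; rewrite inE.
  by exists (c f) => g gH; apply: mono.
exists i => x y xS yS.
apply: connect_sub (conH _ _ (subsetP SH _ xS) (subsetP SH _ yS)).
move=> a b ab; apply: connect1; rewrite /color_adj -mem_edges (Hi _ ab) eqxx.
by rewrite andbT (subsetP (sub_edgesP H)).
Qed.

(** Enlarging [u, v, x] to a set of size [k] reduces every [k >= 3] to the case
    of triples. *)
Lemma MX_coloring_triple (c : coloring G) k (u v x : G) :
  3 <= k <= #|G| -> MX_coloring k c ->
  exists i, connect (color_adj c i) v u && connect (color_adj c i) v x.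
Proof.
case/andP=> k3 kG mx.
have [|S AS cS] := @exists_superset_card G (u |: [set v; x]) k.
  rewrite kG (leq_trans _ k3) // cardsU1 cards2.
  by case: (_ \notin _); case: (_ != _).
have [H /mono_Stree_connect[i conS]] := mx S cS.
by exists i; rewrite !conS // (subsetP AS) // !inE eqxx ?orbT.
Qed.

(** There are [#|G| - 2] edges, one for each vertex other than [u] and [v],
    whose deletion loses no color. *)
Lemma ncolors_upper (c : coloring G) k :
  3 <= k <= #|G| -> MX_coloring k c -> ncolors c <= #|edges G| + 2 - #|G|.
Proof.
move=> kG mx.
have G1 : 1 < #|G|.
  by case/andP: kG => k3 kG; apply: leq_trans kG; apply: ltnW.
have [v [u [_ _ vu]]] := card_gt1P G1.
have [col colP] := fin_all_exists (fun x => MX_coloring_triple u v x kG mx).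
pose edge i := parent_edge (color_adj c i) v.
have edgeP i x : connect (color_adj c i) v x -> x != v ->
    (edge i x \in edges G) /\ c (edge i x) = i.
  move=> vx xv; have [/andP[xy /eqP cxy] _ _] := parentP vx xv.
  by rewrite /edge /parent_edge mem_edges adj_sym setUC.
have edge_inj i x y : connect (color_adj c i) v x -> x != v ->
    connect (color_adj c i) v y -> y != v -> edge i x = edge i y -> x = y.
  exact: parent_edge_inj.
pose X := ~: [set u; v].
have XP x : x \in X -> x != u /\ x != v.
  by rewrite !inE negb_or => /andP[].
pose g x := edge (col x) x.
have gP x : x \in X -> (g x \in edges G) /\ c (g x) = col x.
  by move=> /XP[_ xv]; apply: edgeP => //; case/andP: (colP x).
have g_inj : {in X &, injective g}.
  move=> x y xX yX gxy; have eq_col: col x = col y.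
    by rewrite -(gP x xX).2 -(gP y yX).2 gxy.
  have [/andP[_ vx] /andP[_ vy]] := (colP x, colP y).
  have [[_ xv] [_ yv]] := (XP _ xX, XP _ yX).
  by apply: (edge_inj (col y)) => //; rewrite -{1}eq_col.
pose M := g @: X.
have ME : M \subset edges G by apply/subsetP=> _ /imsetP[x /gP[? _] ->].
have cardM : #|M| + 2 = #|G|.
  rewrite card_in_imset // addnC -(cardsC [set u; v]) cards2.
  by rewrite eq_sym vu.
have le_colors : ncolors c <= #|edges G :\: M|.
  rewrite /ncolors -(size_image c); apply: uniq_leq_size (undup_uniq _) _.
  move=> i; rewrite mem_undup => /imageP[f fE ->].
  (* An edge outside [M] witnesses its own color; [g x] is replaced by the edge
     owned by [u] in the same search tree. *)
  have [/imsetP[x xX f_gx]|fM] := boolP (f \in M); last first.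
    by apply: image_f; rewrite inE fM.
  have [_ c_gx] := gP x xX; have /andP[vu_col vx_col] := colP x.
  have uv : u != v by rewrite eq_sym.
  have [eE ce] := edgeP _ _ vu_col uv.
  rewrite f_gx c_gx -{1}ce; apply: image_f; rewrite inE eE andbT.
  apply/imsetP => -[y yX e_gy]; have [yu yv] := XP _ yX.
  have eq_col : col x = col y by rewrite -ce e_gy (gP y yX).2.
  have /andP[_ vy] := colP y.
  have uy : u = y.
    by apply: (edge_inj (col x)); rewrite // ?e_gy ?/g eq_col.
  by rewrite -uy eqxx in yu.
rewrite -cardM subnDr; apply: leq_trans le_colors _.
by rewrite cardsD (setIidPr ME).
Qed.

(** Color 0 is shared by [F]; the successor of the rank of an edge serves as
    its private color outside [F]. *)
Lemma ncolors_collapse (F : {set {set G}}) : F \subset edges G -> F != set0 ->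
  exists c : coloring G,
    {in F &, forall f g, c f = c g} /\ ncolors c = (#|edges G :\: F|).+1.
Proof.
move=> FE /set0Pn[f0 f0F].
pose c (f : {set G}) := if f \in F then 0 else (enum_rank f).+1.
exists c; split=> [f g fF gF|]; first by rewrite /c fF gF.
rewrite /ncolors -(size_image c) -[RHS]/(size (0 :: image c (edges G :\: F))).
apply/perm_size/uniq_perm; first exact: undup_uniq.
  rewrite /= map_inj_in_uniq ?enum_uniq ?andbT; last first.
    move=> f g; rewrite !mem_enum !inE /c.
    case/andP=> /negPf-> _ /andP[/negPf-> _] [] /val_inj; exact: enum_rank_inj.
  by apply/imageP=> -[f]; rewrite inE /c => /andP[/negPf-> _].
move=> i; rewrite mem_undup inE; apply/imageP/orP.
  case=> f fE ->; have [fF|fF] := boolP (f \in F).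
    by left; rewrite /c fF.
  by right; apply: image_f; rewrite inE fF.
case=> [/eqP->|/imageP[f]]; first by exists f0; rewrite ?(subsetP FE) // /c f0F.
by rewrite inE => /andP[_ fE] ->; exists f.
Qed.

(** The edges owned by the vertices other than the root form the tree: following
    parents leads to the root, and ownership counts the edges. *)
Lemma spanning_tree : connected_graph G ->
  exists H : subgraph G,
    [/\ is_tree H, sub_vertices H = setT & (#|sub_edges H|).+1 = #|G|].
Proof.
case=> /card_gt0P[v _] con.
pose par := parent (@adj G) v; pose d := dist (@adj G) v.
pose edge := parent_edge (@adj G) v.
have parP x : x != v -> adj (par x) x /\ d (par x) < d x.
  by move=> xv; have [] := parentP (con v x) xv.
pose F := edge @: [set~ v].
have FE : F \subset edges G.
  apply/subsetP=> _ /imsetP[x xv ->].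
  by rewrite mem_edges adj_sym; apply: (parP x _).1; rewrite !inE in xv.
pose H := @Subgraph G setT F FE (fun f _ => subsetT f).
have cardF : (#|F|).+1 = #|G|.
  rewrite card_in_imset; first last.
    by move=> x y; rewrite !inE => xv yv; apply: parent_edge_inj.
  by rewrite cardsC1 prednK //; apply/card_gt0P; exists v.
have H_sym : symmetric (sub_adj H) by move=> x y; rewrite /sub_adj setUC.
exists H; split=> //; split; [split|].
- by apply/set0Pn; exists v; rewrite inE.
- have to_v x : connect (sub_adj H) x v.
    have [n] := ubnP (d x); elim: n x => // n IHn x; rewrite ltnS => dx.
    have [->|xv] := eqVneq x v; first exact: connect0.
    apply: connect_trans (IHn (par x) _); last first.
      by apply: leq_trans dx; exact: (parP x xv).2.
    by apply/connect1/imset_f; rewrite !inE.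
  move=> x y _ _; apply: connect_trans (to_v x) _.
  by rewrite (sym_connect_sym H_sym).
apply: (@parent_cycle_free _ d par) => // x y /imsetP[z].
rewrite !inE => zv /set2_eq [[-> ->]//|[-> ->]].
by rewrite leqNgt (parP z zv).2.
Qed.

End Graph.

Theorem theorem2p2 (G : sgraph) (n m k : nat) :
  connected_graph G -> #|G| = n -> #|edges G| = m ->
  3 <= k <= n -> is_mx G k (m + 2 - n).
Proof.
move=> con <- <- kG; split; last first.
  by move=> c; apply: ncolors_upper.
have [H [tree VH cardF]] := spanning_tree con.
have F0 : sub_edges H != set0.
  apply/eqP=> F0; case/andP: kG => k3 /(leq_trans k3).
  by rewrite -cardF F0 cards0.
have [c [mono cN]] := ncolors_collapse (sub_edgesP H) F0.
exists c; first by move=> S _; exists H; split; rewrite ?VH.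
rewrite cN cardsD (setIidPr (sub_edgesP H)) -cardF addn2 subSS.
by rewrite subSn // subset_leq_card // sub_edgesP.
Qed.
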